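(* Let $p$ be a prime and $n\ge1$. Let $P\cong(\mathbb Z/p\mathbb Z)^n$, and let $G=\operatorname{Cay}(P,S)$ have regularity $k=|S|$. The following conditions are equivalent. (i) $G$ admits a $\Gamma$-distance magic labeling for some abelian group $\Gamma$ of order $|P|$. (ii) $G$ is $P$-distance magic. (iii) The regularity $k$ is divisible by $p$. Thus, if $p\nmid k$, no abelian group of order $|P|$ gives a distance magic labeling, while if $p\mid k$, the prescribed group $P$ does.
   Context: For a finite group $P$ and an inverse-closed set $S\subseteq P\setminus\{1\}$ (where $1$ denotes the identity element), $\operatorname{Cay}(P,S)$ is the graph with vertex set $P$ in which $x$ is adjacent to $y$ if and only if $x^{-1}y\in S$ (in additive notation, $y-x\in S$). For an abelian group $\Gamma$ with $|\Gamma|=|V(G)|$, a $\Gamma$-distance magic labeling of $G$ is a bijection $f\colon V(G)\to\Gamma$ for which there is $\gamma\in\Gamma$ with $\sum_{u\in N_G(v)}f(u)=\gamma$ for every $v\in V(G)$, where $N_G(v)$ is the open neighborhood. $G$ is $\Gamma$-distance magic if it admits such a labeling. *)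

(* Defs.v *)
From HB Require Import structures.
From mathcomp Require Import all_boot all_order all_algebra all_fingroup.
Set Implicit Arguments.
Unset Strict Implicit.
Unset Printing Implicit Defensive.

Import GroupScope GRing.Theory.

(* A simple graph on a finite type is represented by its adjacency relation;
   for Cayley graphs, symmetry and irreflexivity are cay_sym and cay_irrefl. *)

Definition inverse_closed (P : finGroupType) (S : {set P}) : Prop :=
  forall s : P, s \in S -> s^-1 \in S.

Definition cay (P : finGroupType) (S : {set P}) : rel P :=
  fun x y => x^-1 * y \in S.

Definition open_nbhd (V : finType) (e : rel V) (v : V) : {set V} :=
  [set u | e v u].

Definition regular (V : finType) (e : rel V) (k : nat) : Prop :=
  forall v : V, #|open_nbhd e v| = k.

Definition distance_magic_labeling (V : finType) (e : rel V)
    (Gamma : finZmodType) (f : V -> Gamma) : Prop :=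
  bijective f /\
  exists gamma : Gamma,
    forall v : V, (\sum_(u in open_nbhd e v) f u)%R = gamma.

Definition distance_magic (V : finType) (e : rel V) (Gamma : finZmodType) :
    Prop :=
  #|Gamma| = #|V| /\ exists f : V -> Gamma, distance_magic_labeling e f.

Lemma cay_irrefl (P : finGroupType) (S : {set P}) :
  1 \notin S -> irreflexive (cay S).
Proof. by move=> S1 x; rewrite /cay mulVg; apply: negbTE. Qed.

Lemma cay_sym (P : finGroupType) (S : {set P}) :
  inverse_closed S -> symmetric (cay S).
Proof.
move=> SV x y; rewrite /cay.
by apply/idP/idP => /SV; rewrite invMg invgK.
Qed.

Lemma cay_regular (P : finGroupType) (S : {set P}) : regular (cay S) #|S|.
Proof.
move=> x; rewrite -(card_lcoset S x); apply: eq_card => y.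
by rewrite inE mem_lcoset.
Qed.

(* A finZmodType is also canonically a finGroupType, with the group law of %g
   being its addition; so cay applies to it, in additive notation. *)
Lemma cay_additive (P : finZmodType) (S : {set P}) (x y : P) :
  cay S x y = ((y - x)%R \in S).
Proof. by rewrite addrC. Qed.

(* Main.v *)
Require Import Defs.
From mathcomp Require Import all_boot all_order all_algebra all_fingroup.
From mathcomp Require Import all_solvable all_character.

(** If [p] divides [k], the identity labeling works: every neighborhood sum is
    [k v + \sum_(s in S) s], which does not depend on [v].  Conversely, a
    labeling multiplied by a suitable power of [p] takes values in the
    [p]-torsion of Gamma, is not constant and still has constant neighborhood
    sums.  In characteristic [p] the [p]-th power of the adjacency operator
    [\sum_(s in S) s] of the group ring is [\sum_(s in S) s ^ p = k], so [k]
    times the labeling is constant and [p] must divide [k]. *)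

Set Implicit Arguments.
Unset Strict Implicit.
Unset Printing Implicit Defensive.

Import GroupScope GRing.Theory FinRing.Theory.
Local Open Scope ring_scope.

(** Frobenius is additive on commuting elements; matrix rings are not commutative, so commutation is
    asked of the summands alone. *)
Lemma expr_sum_comm_pchar (R : nzRingType) (p : nat) (I : Type) (r : seq I)
    (A : pred I) (F : I -> R) :
  p \in [pchar R] -> (forall i j, GRing.comm (F i) (F j)) ->
  (\sum_(i <- r | A i) F i) ^+ p = \sum_(i <- r | A i) F i ^+ p.
Proof.
move=> pcharR Fcomm; rewrite -(pFrobenius_autE pcharR).
elim: r => [|i r IHr]; first by rewrite !big_nil pFrobenius_aut0.
rewrite !big_cons; case: ifP => // _.
by rewrite pFrobenius_autD_comm ?IHr ?pFrobenius_autE //; apply: commr_sum.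
Qed.

Lemma repr_sum_exp_abelem (p m : nat) (P : finGroupType)
    (rP : mx_representation 'F_p [set: P] m) (S : {set P}) :
  prime p -> p.-abelem [set: P] ->
  (\sum_(s in S) rP s) ^+ p = #|S|%:R :> 'M_m.
Proof.
move=> p_pr /(abelemP p_pr)[abP expP].
(* Matrices of size 0 form the zero ring, which has no characteristic [p]. *)
case: m rP => [|m] rP; first by rewrite [LHS]flatmx0 [RHS]flatmx0.
have pcharM : p \in [pchar 'M['F_p]_m.+1].
  rewrite (rmorph_pchar (@scalar_mx 'F_p m.+1)) //.
  exact: pchar_Fp.
rewrite (expr_sum_comm_pchar _ _ pcharM) => [|x y]; last first.
  rewrite /GRing.comm -!repr_mxMr ?inE //.
  by congr (rP _); apply: (centsP abP); rewrite inE.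
rewrite (eq_bigr (fun=> 1)) ?sumr_const // => s _.
by rewrite -repr_mxX ?inE // expP ?inE // repr_mx1.
Qed.

Lemma sum_open_nbhd_cay (P : finGroupType) (V : nmodType) (S : {set P})
    (h : P -> V) (x : P) :
  \sum_(u in open_nbhd (cay S) x) h u = \sum_(s in S) h (x * s)%g.
Proof.
rewrite (reindex_inj (mulgI x)) /=; apply: eq_bigl => s.
by rewrite inE /cay mulKg.
Qed.

(** The rows of [H] are the values of [h], and [A] acts as the adjacency matrix. [A] sends [H] to a
    matrix with constant rows and scales [one] by [k = #|S|], so every positive power of [A] sends
    [H] to constant rows. Since [A ^+ p] is the scalar [k], which is invertible in ['F_p], [h] is
    constant. *)
Lemma cay_sum_const_rV (p m : nat) (P : finGroupType) (S : {set P})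
    (h : P -> 'rV['F_p]_m) (c : 'rV_m) :
    prime p -> p.-abelem [set: P] -> ~~ (p %| #|S|)%N ->
    (forall x, \sum_(u in open_nbhd (cay S) x) h u = c) ->
  forall x y, h x = h y.
Proof.
move=> p_pr abP pNS hc.
pose rP := regular_repr 'F_p [set: P]; pose A := \sum_(s in S) rP s.
pose H := \matrix_(i < #|[set: P]|) h (enum_val i).
pose one := const_mx 1 : 'cV['F_p]_#|[set: P]|.
(* In the regular representation, [s] sends the basis vector of [x] to that of [x * s], a neighbor
   of [x]. *)
have rowA q (B : 'M_(_, q)) i : row i (A *m B) =
    \sum_(s in S) row (gring_index [set: P] (enum_val i * s)%g) B.
  rewrite row_mul linear_sum mulmx_suml; apply: eq_bigr => s _ /=.
  by rewrite rowK -rowE.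
have rowH i : row i H = h (enum_val i) by rewrite rowK.
have row1 i (d : 'rV['F_p]_m) : row i (one *m d) = d.
  rewrite row_mul; apply/rowP => j.
  by rewrite !mxE big_ord1 !mxE mul1r.
have AH : A *m H = one *m c.
  apply/row_matrixP => i; rewrite row1 rowA -(hc (enum_val i)).
  rewrite sum_open_nbhd_cay; apply: eq_bigr => s _.
  by rewrite rowH gring_indexK ?inE.
have A1 : A *m one = #|S|%:R *: one.
  apply/row_matrixP => i; rewrite rowA linearZ /=.
  rewrite (eq_bigr (fun=> row i one)) ?sumr_const ?scaler_nat // => s _.
  by apply/rowP => j; rewrite !mxE.
have AHexp r : exists d, A ^+ r.+1 *m H = one *m d.
  elim: r => [|r [d IHr]].
    by exists c; rewrite expr1.
  exists (#|S|%:R *: d).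
  by rewrite exprS -mulmxA IHr mulmxA A1 -scalemxAl -scalemxAr.
have [d] := AHexp p.-1; rewrite (prednK (prime_gt0 p_pr)) => AHd.
have kh x : #|S|%:R *: h x = d.
  rewrite -[d](row1 (gring_index [set: P] x)) -AHd repr_sum_exp_abelem //.
  by rewrite -scaler_nat -scalemxAl mul1mx linearZ /= rowH gring_indexK ?inE.
move=> x y; apply: (@scalerI _ _ (#|S|%:R : 'F_p)); last by rewrite !kh.
by rewrite -(dvdn_pcharf (pchar_Fp p_pr)).
Qed.

Lemma cay_sum_const_abelem (p : nat) (P : finGroupType) (V : finZmodType)
    (E : {group V}) (S : {set P}) (h : P -> V) (c : V) :
    prime p -> p.-abelem [set: P] -> p.-abelem E -> ~~ (p %| #|S|)%N ->
    (forall x, h x \in E) ->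
    (forall x, \sum_(u in open_nbhd (cay S) x) h u = c) ->
  forall x y, h x = h y.
Proof.
move=> p_pr abP abE pNS Eh hc x y.
(* The coordinates [abelem_rV] of [E] over ['F_p] require [E] to be nontrivial. *)
have [E1|ntE] := eqVneq (E : {set V}) 1%g.
  by move: (Eh x) (Eh y); rewrite E1 => /set1P-> /set1P->.
apply: (abelem_rV_inj (abelE := abE) (ntE := ntE)) => //.
pose phi := abelem_rV abE ntE.
apply: (@cay_sum_const_rV p _ P S (phi \o h) (phi c)) => // z.
rewrite -(hc z); apply/esym.
by apply: (morph_prod (abelem_rV_morphism abE ntE)) => u _; apply: Eh.
Qed.

Lemma exists_pmuln_torsion (p : nat) (Gamma : finZmodType) :
    prime p -> p.-group [set: Gamma] -> (1 < #|Gamma|)%N ->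
  exists q, (forall x : Gamma, x *+ q \in 'Ohm_1([set: Gamma]))
            /\ exists x : Gamma, x *+ q != 0.
Proof.
move=> p_pr pG ntG.
have /p_natP[e expE] : p.-nat (exponent [set: Gamma]) by rewrite pnat_exponent.
have abG : abelian [set: Gamma] by exact: FinRing.zmod_abelian.
have e_gt0 : (0 < e)%N.
  rewrite lt0n; apply: contraTneq ntG => e0.
  have /eqP G1 : [set: Gamma] == 1%g by rewrite trivg_exponent expE e0.
  by rewrite -cardsT G1 cards1.
(* With exponent [p ^ e], this is the largest power of [p] that does not annihilate [Gamma]; one
   more factor [p] does. *)
exists (p ^ e.-1)%N; split=> [x|].
  rewrite (OhmEabelian pG) ?(abelianS (Ohm_sub _ _)) // !inE /=.
  rewrite -!zmodXgE -expgM -expnSr prednK //.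
  by rewrite -expE expg_exponent ?inE.
apply/forallPn/negP => /forallP expq.
have : (exponent [set: Gamma] %| p ^ e.-1)%N.
  by apply/exponentP => x _; rewrite zmodXgE; apply/eqP/expq.
by rewrite expE dvdn_Pexp2l ?prime_gt1 // -ltnS prednK // ltnn.
Qed.

Lemma cay_distance_magic_dvdn (p : nat) (P : finGroupType) (S : {set P})
    (Gamma : finZmodType) :
    prime p -> p.-abelem [set: P] -> (1 < #|P|)%N ->
  distance_magic (cay S) Gamma -> (p %| #|S|)%N.
Proof.
move=> p_pr abP ntP [cardG [f [[g _ gK] [gamma fgamma]]]].
apply/negPn/negP => pNS.
have pG : p.-group [set: Gamma].
  by move: (abelem_pgroup abP); rewrite /pgroup !cardsT cardG.
have abG : abelian [set: Gamma] by exact: FinRing.zmod_abelian.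
have ntG : (1 < #|Gamma|)%N by rewrite cardG.
have [q [Ohmq [x]]] := exists_pmuln_torsion p_pr pG ntG.
(* Surjectivity of [f] makes [x *+ q] and [0] two values of the function [f u *+ q], so its
   constancy is the contradiction sought. *)
case/eqP; rewrite -(mul0rn Gamma q) -[x]gK -[0]gK.
apply: (@cay_sum_const_abelem p P Gamma _ S (fun u => f u *+ q) (gamma *+ q)
          p_pr abP (Ohm1_abelem pG abG)) => // v.
by rewrite sumrMnl fgamma.
Qed.

Lemma dvdn_cay_distance_magic (p : nat) (P : finZmodType) (S : {set P}) :
    (forall x : P, x *+ p = 0) -> (p %| #|S|)%N ->
  distance_magic (cay S) P.
Proof.
move=> expP /dvdnP[m pS]; split=> //; exists id; split; first by exists id.
exists (\sum_(s in S) s) => v; rewrite sum_open_nbhd_cay.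
rewrite (eq_bigr (fun s => v + s)) // big_split sumr_const pS mulnC mulrnA.
by rewrite expP mul0rn /= add0r.
Qed.

Lemma abelem_rV_Zp (p n : nat) :
  prime p -> p.-abelem [set: 'rV['Z_p]_n].
Proof.
move=> p_pr; apply/(abelemP p_pr); split; first exact: FinRing.zmod_abelian.
move=> v _; rewrite zmodXgE; apply/rowP => i.
by rewrite mulmxnE mxE -mulr_natl pchar_Zp ?mul0r ?prime_gt1.
Qed.

Theorem theorem5p5 (p n : nat) (p_prime : prime p) (n_ge1 : (1 <= n)%N)
    (P : finZmodType)
    (P_isog : isog [set: P]%g [set: 'rV['Z_p]_n]%g)
    (S : {set P}) (S_1 : (1%g : P) \notin S) (S_inv : inverse_closed S)
    (k : nat) (k_S : k = #|S|) :
  [<-> exists Gamma : finZmodType,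
         #|Gamma| = #|P| /\ distance_magic (cay S) Gamma;
       distance_magic (cay S) P;
       (p %| k)%N]
  /\ (~~ (p %| k)%N ->
        forall Gamma : finZmodType,
          #|Gamma| = #|P| -> ~ distance_magic (cay S) Gamma)
  /\ ((p %| k)%N -> distance_magic (cay S) P).
Proof.
have abP : p.-abelem [set: P] by rewrite (isog_abelem P_isog) abelem_rV_Zp.
have ntP : (1 < #|P|)%N.
  have p_gt1 := prime_gt1 p_prime.
  rewrite -cardsT (card_isog P_isog) cardsT card_mx mul1n card_ord Zp_cast //.
  by rewrite -(exp1n n) ltn_exp2r.
have magic_dvd Gamma : distance_magic (cay S) Gamma -> (p %| k)%N.
  by rewrite k_S; apply: cay_distance_magic_dvdn.
have dvd_magic : (p %| k)%N -> distance_magic (cay S) P.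
  rewrite k_S; apply: dvdn_cay_distance_magic => x.
  by case/(abelemP p_prime): abP => _ expP; rewrite -zmodXgE expP ?inE.
split; last by split=> // pNk Gamma _ /magic_dvd; apply/negP.
(* The passage from an arbitrary [Gamma] to [P] goes through the divisibility of [k]. *)
tfae=> [[Gamma [_]] /magic_dvd/dvd_magic | /magic_dvd | /dvd_magic magicP] //.
by exists P.
Qed.
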